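(* Let $n=pq$ be a product of two primes. Put $a=1$, $b=-16n$, $c=2n^4+92n^2+2$, $d=-(16n^5+224n^3+16n)$, and let $e$ be a rational number with $e^2=n^8+28n^6+198n^4+28n^2+1$. Let $J_Q$ be the curve $$J_Q(X,Z):\quad Z^2=aX^4+bX^3+cX^2+dX+e^2.$$ Then $J_Q(X,Z)$ is isomorphic to the Weierstrass equation over $\mathbb Q$ $$E_w(x,y)_{\mid\mathbb Q}:\quad y^2+a_1xy+a_3y=x^3+a_2x^2+a_4x+a_6,$$ with $$a_1=\frac de,\quad a_3=2eb,\quad a_2=c-\frac{d^2}{4e^2},\quad a_4=-4e^2a,\quad a_6=a\,(d^2-4e^2c),$$ through the isomorphism $$\mathcal J:\ J_Q(X,Z)\longrightarrow E_w(x,y)_{\mid\mathbb Q},\qquad (X,Z)\longmapsto\left(\frac{2e(Z+e)+dX}{X^2},\ \frac{4e^2(Z+e)+2e(dX+cX^2)-\frac{d^2X^2}{2e}}{X^3}\right),$$ whose inverse is $$\mathcal J^{-1}:\ E_w(x,y)_{\mid\mathbb Q}\longrightarrow J_Q(X,Z),\qquad (x,y)\longmapsto\left(\frac{2e(x+c)-\frac{d^2}{2e}}{y},\ -e+\frac{X(Xx-d)}{2e}\right),$$ where, in the second coordinate of $\mathcal J^{-1}(x,y)$, $X$ denotes the first coordinate $\frac{2e(x+c)-\frac{d^2}{2e}}{y}$.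
   Context: $J_Q$ (called a Jacobi quartic) and $E_w$ are plane curves given by the displayed equations, and $E_w(x,y)_{\mid\mathbb Q}$ denotes the Weierstrass curve considered over $\mathbb Q$.
   Formalization: As e²=(n⁴+14n²+1)², J_Q is reducible and J contracts one component to the node of E_w, so ''isomorphic'' is false; proved instead: J and J⁻¹ are rational maps, inverse wherever the composites are defined, on nonempty opens, with only J∘J⁻¹ densely defined (on E_w). *)

(* Defs.v *)
From HB Require Import structures.
From mathcomp Require Import all_boot all_order all_algebra.
From mathcomp Require Import fraction mpoly.

Set Implicit Arguments.
Unset Strict Implicit.
Unset Printing Implicit Defensive.

Import GRing.Theory.
Local Open Scope ring_scope.

(* An affine plane curve over Q is given by its equation F = 0.  Points are
   taken in every field extension iota : Q -> K, so that an assertion about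
   all of them concerns the curve over Q and not only its rational points. *)
Notation plane_poly := {mpoly rat[2]}.
Notation plane_fun := {fraction {mpoly rat[2]}}.

Definition peval (K : fieldType) (iota : {rmorphism rat -> K})
    (F : plane_poly) (P : K * K) : K :=
  mmap iota (fun i : 'I_2 => if i == 0 then P.1 else P.2) F.

Definition on_curve (K : fieldType) (iota : {rmorphism rat -> K})
    (F : plane_poly) (P : K * K) : Prop := peval iota F P = 0.

(* f is regular at P with value v: some representation of f as a quotient of
   polynomials has a denominator that does not vanish at P. *)
Definition fun_at (K : fieldType) (iota : {rmorphism rat -> K})
    (f : plane_fun) (P : K * K) (v : K) : Prop :=
  exists num den : plane_poly,
    [/\ f = tofrac num / tofrac den, peval iota den P != 0
      & v = peval iota num P / peval iota den P].

Definition map_at (K : fieldType) (iota : {rmorphism rat -> K})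
    (f : plane_fun * plane_fun) (P Q : K * K) : Prop :=
  fun_at iota f.1 P Q.1 /\ fun_at iota f.2 P Q.2.

(* f is regular on a dense open subset of the curve F = 0, that is, at all but
   finitely many of its points, and maps these points to the curve G = 0. *)
Definition rational_map (F G : plane_poly) (f : plane_fun * plane_fun) : Prop :=
  forall (K : fieldType) (iota : {rmorphism rat -> K}),
    (exists s : seq (K * K), forall P, on_curve iota F P -> P \notin s ->
       exists Q, map_at iota f P Q) /\
    (forall P Q, on_curve iota F P -> map_at iota f P Q -> on_curve iota G Q).

(* The composite of f followed by g is the identity of the curve F = 0 at
   every point where it is defined. *)
Definition left_inverse (F : plane_poly) (f g : plane_fun * plane_fun) : Prop :=
  forall (K : fieldType) (iota : {rmorphism rat -> K}) (P Q R : K * K),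
    on_curve iota F P -> map_at iota f P Q -> map_at iota g Q R -> R = P.

(* f and g are mutually inverse rational maps over Q between F = 0 and G = 0.
   The last clause says that the open subsets U of F = 0 and V of G = 0 on
   which they restrict to inverse isomorphisms are nonempty. *)
Definition isomorphic_via (F G : plane_poly) (f g : plane_fun * plane_fun)
    : Prop :=
  [/\ rational_map F G f, rational_map G F g,
      left_inverse F f g, left_inverse G g f
    & exists (K : fieldType) (iota : {rmorphism rat -> K}) (P Q : K * K),
        [/\ on_curve iota F P, on_curve iota G Q,
            map_at iota f P Q & map_at iota g Q P]].

(* The composite of f followed by g is defined at all but finitely many points
   of F = 0.  When both curves are irreducible this follows from
   isomorphic_via F G f g; it is not included there because it fails for
   F = jacobi_quartic a b c d e when b, c, d, e are as in the theorem:
     e ^+ 2 = (n ^+ 4 + 14 * n ^+ 2 + 1) ^+ 2, so the quartic is the union of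
     Z = X ^+ 2 - 8 * n * X + (n ^+ 4 + 14 * n ^+ 2 + 1) and of
     Z = - (X ^+ 2 - 8 * n * X + (n ^+ 4 + 14 * n ^+ 2 + 1)),
   and jacobi_to_weierstrass contracts one of these two components to the
   singular point of the Weierstrass cubic. *)
Definition composite_dense (F : plane_poly) (f g : plane_fun * plane_fun)
    : Prop :=
  forall (K : fieldType) (iota : {rmorphism rat -> K}),
    exists s : seq (K * K), forall P, on_curve iota F P -> P \notin s ->
      exists Q R, map_at iota f P Q /\ map_at iota g Q R.

Definition coord1 : plane_poly := 'X_(0 : 'I_2).
Definition coord2 : plane_poly := 'X_(1 : 'I_2).

Definition jacobi_quartic (a b c d e : rat) : plane_poly :=
  let X := coord1 in let Z := coord2 in
  Z ^+ 2 - (a%:MP * X ^+ 4 + b%:MP * X ^+ 3 + c%:MP * X ^+ 2 + d%:MP * X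
            + e%:MP ^+ 2).

Definition weierstrass (a1 a2 a3 a4 a6 : rat) : plane_poly :=
  let x := coord1 in let y := coord2 in
  y ^+ 2 + a1%:MP * x * y + a3%:MP * y
  - (x ^+ 3 + a2%:MP * x ^+ 2 + a4%:MP * x + a6%:MP).

Definition cst (r : rat) : plane_fun := tofrac (r%:MP : plane_poly).

Definition jacobi_to_weierstrass (c0 d0 e0 : rat) : plane_fun * plane_fun :=
  let X := tofrac coord1 in let Z := tofrac coord2 in
  let c := cst c0 in let d := cst d0 in let e := cst e0 in
  ((2 * e * (Z + e) + d * X) / X ^+ 2,
   (4 * e ^+ 2 * (Z + e) + 2 * e * (d * X + c * X ^+ 2)
    - d ^+ 2 * X ^+ 2 / (2 * e)) / X ^+ 3).

Definition weierstrass_to_jacobi (c0 d0 e0 : rat) : plane_fun * plane_fun :=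
  let x := tofrac coord1 in let y := tofrac coord2 in
  let c := cst c0 in let d := cst d0 in let e := cst e0 in
  let X := (2 * e * (x + c) - d ^+ 2 / (2 * e)) / y in
  (X, - e + X * (X * x - d) / (2 * e)).

(* Main.v *)
(* Put A = c - d^2/(4e^2).  The two maps read
     x = (2e(Z + e) + dX)/X^2,  y = 2e(x + A)/X   and
     X = 2e(x + A)/y,  Z = -e + X(Xx - d)/(2e),
   so each inverts the other by substitution, and the cubic becomes
     y^2 + a1 xy + a3 y = (x + A)(x^2 - 4e^2).
   Writing J and W for the left-hand minus the right-hand sides of the two
   curve equations, substitution gives W = -4e^2 (x + A)/X^4 * J, hence the
   maps carry either curve to the other.  They are regular exactly where X, y
   respectively do not vanish, which excludes finitely many points.  The point
   (8n, e) of the quartic, where 2e(Z + e) + dX + AX^2 = 4e^2, shows that the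
   maps are not vacuously inverse to each other. *)
Require Import Defs.
From HB Require Import structures.
From mathcomp Require Import all_boot all_order all_algebra.
From mathcomp Require Import fraction mpoly.
From mathcomp Require Import ring lra.

Import GRing.Theory.
Local Open Scope ring_scope.

(** * Evaluation of plane polynomials at points over an extension of Q *)

Lemma peval_coord1 (K : fieldType) (iota : {rmorphism rat -> K}) (P : K * K) :
  peval iota coord1 P = P.1.
Proof. by rewrite /peval mmapX mmap1U. Qed.

Lemma peval_coord2 (K : fieldType) (iota : {rmorphism rat -> K}) (P : K * K) :
  peval iota coord2 P = P.2.
Proof. by rewrite /peval mmapX mmap1U. Qed.

Lemma pevalC (K : fieldType) (iota : {rmorphism rat -> K}) (r : rat)
  (P : K * K) : peval iota r%:MP P = iota r.
Proof. exact: mmapC. Qed.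

Lemma pevalD (K : fieldType) (iota : {rmorphism rat -> K}) (F G : plane_poly)
  (P : K * K) : peval iota (F + G) P = peval iota F P + peval iota G P.
Proof. exact: rmorphD. Qed.

Lemma pevalN (K : fieldType) (iota : {rmorphism rat -> K}) (F : plane_poly)
  (P : K * K) : peval iota (- F) P = - peval iota F P.
Proof. exact: rmorphN. Qed.

Lemma pevalM (K : fieldType) (iota : {rmorphism rat -> K}) (F G : plane_poly)
  (P : K * K) : peval iota (F * G) P = peval iota F P * peval iota G P.
Proof. exact: rmorphM. Qed.

Lemma pevalXn (K : fieldType) (iota : {rmorphism rat -> K}) (F : plane_poly)
  (m : nat) (P : K * K) : peval iota (F ^+ m) P = peval iota F P ^+ m.
Proof. exact: rmorphXn. Qed.

Lemma peval_nat (K : fieldType) (iota : {rmorphism rat -> K}) (m : nat)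
  (P : K * K) : peval iota m%:R P = m%:R.
Proof. exact: rmorph_nat. Qed.

Lemma peval0 (K : fieldType) (iota : {rmorphism rat -> K}) (P : K * K) :
  peval iota 0 P = 0.
Proof. exact: rmorph0. Qed.

Definition pevalE := (peval_nat, pevalC, peval_coord1, peval_coord2,
  pevalD, pevalN, pevalM, pevalXn).

(** * Values and poles of rational functions of the plane *)

(** Two representations of one fraction cross-multiply to an identity of polynomials; evaluating it
    at [P], where neither denominator vanishes, gives equal values. *)
Lemma fun_at_quotient (K : fieldType) (iota : {rmorphism rat -> K})
  (num den : plane_poly) (P : K * K) (v : K) : peval iota den P != 0 ->
  fun_at iota (tofrac num / tofrac den) P v <->
  v = peval iota num P / peval iota den P.
Proof.
move=> denP; split=> [|->]; last by exists num, den.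
case=> num' [den' [/eqP eq_f den'P ->]].
have nz (F : plane_poly) : peval iota F P != 0 -> tofrac F != 0.
  apply: contraNneq => /eqP.
  by rewrite tofrac_eq0 => /eqP->; rewrite peval0.
move: eq_f; rewrite eqr_div ?nz // -!tofracM tofrac_eq => /eqP.
move/(congr1 (fun F => peval iota F P)); rewrite !pevalM => eqv.
by apply/eqP; rewrite eqr_div // -eqv.
Qed.

(* num may vanish at P: regularity fails because any other representation
   num' / den' satisfies num' * den = num * den', hence den' vanishes on the
   whole line L and in particular at P = L(t). *)
Lemma fun_at_pole (K : fieldType) (iota : {rmorphism rat -> K})
  (num den : plane_poly) (P : K * K) (v : K) (L : 'I_2 -> {poly K}) (t : K) :
  den != 0 -> (forall i, (L i).[t] = if i == 0 then P.1 else P.2) ->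
  mmap (polyC \o iota) L den = 0 -> mmap (polyC \o iota) L num != 0 ->
  ~ fun_at iota (tofrac num / tofrac den) P v.
Proof.
move=> den0 LP Lden Lnum [num' [den' [/eqP eq_f den'P _]]].
have evalL (F : plane_poly) : (mmap (polyC \o iota) L F).[t] = peval iota F P.
  rewrite /peval /mmap horner_sum; apply: eq_bigr => m _.
  rewrite hornerM hornerC /= /mmap1 horner_prod; congr (_ * _).
  by apply: eq_bigr => i _; rewrite horner_exp LP.
have den'0 : den' != 0.
  by apply: contraNneq den'P => ->; rewrite peval0.
move: eq_f; rewrite eqr_div ?tofrac_eq0 // -!tofracM tofrac_eq => /eqP.
move/(congr1 (mmap (polyC \o iota) L)); rewrite !rmorphM /= Lden mulr0.
move/eqP; rewrite mulf_eq0 (negPf Lnum) /= => /eqP Lden'.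
by move: den'P; rewrite -evalL Lden' horner0 eqxx.
Qed.

Lemma coord1_neq0 : coord1 != 0.
Proof.
apply/eqP => /(congr1 (fun F => peval idfun F (1, 0))).
by rewrite peval_coord1 peval0.
Qed.

Lemma coord2_neq0 : coord2 != 0.
Proof.
apply/eqP => /(congr1 (fun F => peval idfun F (0, 1))).
by rewrite peval_coord2 peval0.
Qed.

Lemma cst_neq0 (r : rat) : r != 0 -> cst r != 0.
Proof. by rewrite tofrac_eq0 mpolyC_eq0. Qed.

Lemma natr_fun_neq0 (m : nat) : (0 < m)%N -> m%:R != 0 :> plane_fun.
Proof.
case: m => // m _.
rewrite -(rmorph_nat (@tofrac plane_poly \o @mpolyC 2 rat)) cst_neq0 //.
by rewrite Num.Theory.pnatr_eq0.
Qed.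

Lemma natr_neq0 (K : fieldType) (iota : {rmorphism rat -> K}) (m : nat) :
  (0 < m)%N -> m%:R != 0 :> K.
Proof.
by case: m => // m _; rewrite -(rmorph_nat iota) fmorph_eq0 Num.Theory.pnatr_eq0.
Qed.

Lemma linear_poly_neq0 (K : fieldType) (r s : K) :
  r != 0 -> r *: 'X + s%:P != 0.
Proof.
move=> r0; apply/eqP => /(congr1 (fun F : {poly K} => F`_1)).
rewrite coefD coefZ coefX coefC coef0 /= mulr1 addr0 => /eqP.
by rewrite (negPf r0).
Qed.

(** * Field identities behind the two maps *)

(** The terms in [c] and [d ^+ 2] merge into [a2]. The field is arbitrary because the identity is
    applied in the function field of the plane. *)
Lemma jacobi_to_weierstrass_snd (F : fieldType) (X Z c d e a2 : F) :
  (2 : F) != 0 -> e != 0 -> X != 0 -> a2 = c - d ^+ 2 / (4 * e ^+ 2) ->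
  (4 * e ^+ 2 * (Z + e) + 2 * e * (d * X + c * X ^+ 2)
    - d ^+ 2 * X ^+ 2 / (2 * e)) / X ^+ 3 =
  2 * e * (2 * e * (Z + e) + d * X + a2 * X ^+ 2) / X ^+ 3.
Proof.
move=> n2 e0 X0 ->; field.
by rewrite X0 e0 n2 (natrM _ 2 2) mulf_neq0.
Qed.

Lemma weierstrass_to_jacobi_fst (F : fieldType) (x y c d e a2 : F) :
  (2 : F) != 0 -> e != 0 -> y != 0 -> a2 = c - d ^+ 2 / (4 * e ^+ 2) ->
  (2 * e * (x + c) - d ^+ 2 / (2 * e)) / y = 2 * e * (x + a2) / y.
Proof.
move=> n2 e0 y0 ->; field.
by rewrite y0 e0 n2 (natrM _ 2 2) mulf_neq0.
Qed.

Lemma weierstrass_to_jacobi_snd (F : fieldType) (x y d e a2 : F) :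
  (2 : F) != 0 -> e != 0 -> y != 0 ->
  let X := 2 * e * (x + a2) / y in
  - e + X * (X * x - d) / (2 * e) =
  ((x + a2) * (2 * e * (x + a2) * x - d * y) - e * y ^+ 2) / y ^+ 2.
Proof. by move=> n2 e0 y0 /=; field; rewrite y0 e0 n2. Qed.

Lemma jacobi_to_weierstrass_eq (F : fieldType) (X Z B C D E A : F) :
  (2 : F) != 0 -> E != 0 -> X != 0 -> A = C - D ^+ 2 / (4 * E ^+ 2) ->
  Z ^+ 2 = X ^+ 4 + B * X ^+ 3 + C * X ^+ 2 + D * X + E ^+ 2 ->
  let x := (2 * E * (Z + E) + D * X) / X ^+ 2 in
  let y := 2 * E * (x + A) / X in
  y ^+ 2 + D / E * x * y + 2 * E * B * y = (x + A) * (x ^+ 2 - 4 * E ^+ 2).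
Proof.
move=> n2 E0 X0 defA /eqP eqJ x y; apply/eqP; rewrite -subr_eq0.
have n4 : 4 != 0 :> F by rewrite (natrM _ 2 2) mulf_neq0.
have -> : y ^+ 2 + D / E * x * y + 2 * E * B * y
          - (x + A) * (x ^+ 2 - 4 * E ^+ 2) =
    - (x + A) * (4 * E ^+ 2) / X ^+ 4
    * (Z ^+ 2 - (X ^+ 4 + B * X ^+ 3 + C * X ^+ 2 + D * X + E ^+ 2)).
  by rewrite /y /x defA; field; rewrite ?X0 ?E0 ?n4 ?n2.
by move: eqJ; rewrite -subr_eq0 => /eqP->; rewrite mulr0.
Qed.

Lemma weierstrass_to_jacobi_eq (F : fieldType) (x y B C D E A : F) :
  (2 : F) != 0 -> E != 0 -> y != 0 -> A = C - D ^+ 2 / (4 * E ^+ 2) ->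
  y ^+ 2 + D / E * x * y + 2 * E * B * y = (x + A) * (x ^+ 2 - 4 * E ^+ 2) ->
  let X := 2 * E * (x + A) / y in
  let Z := - E + X * (X * x - D) / (2 * E) in
  Z ^+ 2 = X ^+ 4 + B * X ^+ 3 + C * X ^+ 2 + D * X + E ^+ 2.
Proof.
move=> n2 E0 y0 defA /eqP eqW X Z; apply/eqP; rewrite -subr_eq0.
have n4 : 4 != 0 :> F by rewrite (natrM _ 2 2) mulf_neq0.
(* The cofactor is the inverse -X^4/(4E^2(x + A)) of the one for the other map, rewritten with X =
   2E(x + A)/y; in this form it has no pole at x = -A. *)
have -> : Z ^+ 2 - (X ^+ 4 + B * X ^+ 3 + C * X ^+ 2 + D * X + E ^+ 2) =
    - (4 * E ^+ 2) * (x + A) ^+ 3 / y ^+ 4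
    * (y ^+ 2 + D / E * x * y + 2 * E * B * y
       - (x + A) * (x ^+ 2 - 4 * E ^+ 2)).
  by rewrite /Z /X defA; field; rewrite ?y0 ?E0 ?n4 ?n2.
by move: eqW; rewrite -subr_eq0 => /eqP->; rewrite mulr0.
Qed.

(** * The two maps as quotients of polynomials, and where they are regular *)

Section Maps.

Variables (c d e a2 : rat).
Hypotheses (e_neq0 : e != 0) (a2_def : a2 = c - d ^+ 2 / (4 * e ^+ 2)).

(** The numerators belong to the denominators X^2, X^3 for the map to the cubic and y, y^2 for the
    map back; with [a2] as a constant, no division by e remains in them. *)
Definition jw_num1 : plane_poly :=
  2 * e%:MP * (coord2 + e%:MP) + d%:MP * coord1.
Definition jw_num2 : plane_poly :=
  2 * e%:MP * (jw_num1 + a2%:MP * coord1 ^+ 2).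
Definition wj_num1 : plane_poly := 2 * e%:MP * (coord1 + a2%:MP).
Definition wj_num2 : plane_poly :=
  (coord1 + a2%:MP) * (2 * e%:MP * (coord1 + a2%:MP) * coord1 - d%:MP * coord2)
  - e%:MP * coord2 ^+ 2.

Let cst_a2 : cst a2 = cst c - cst d ^+ 2 / (4 * cst e ^+ 2).
Proof.
pose phi := (@tofrac plane_poly \o @mpolyC 2 rat : {rmorphism rat -> plane_fun}).
rewrite a2_def -[cst _]/(phi _) (rmorphB phi) (fmorph_div phi).
by rewrite (rmorphXn phi) (rmorphM phi) (rmorphXn phi) (rmorph_nat phi).
Qed.

Lemma jacobi_to_weierstrassE : jacobi_to_weierstrass c d e =
  (tofrac jw_num1 / tofrac (coord1 ^+ 2), tofrac jw_num2 / tofrac (coord1 ^+ 3)).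
Proof.
rewrite /jacobi_to_weierstrass /jw_num2 /jw_num1.
rewrite !(tofracXn, tofracD, tofracM, rmorph_nat).
rewrite -![tofrac _%:MP]/(cst _).
have n2 := natr_fun_neq0 2 isT; have e0 := cst_neq0 _ e_neq0.
have X0 : tofrac coord1 != 0 by rewrite tofrac_eq0 coord1_neq0.
by rewrite (jacobi_to_weierstrass_snd _ _ _ _ _ _ _ n2 e0 X0 cst_a2).
Qed.

Lemma weierstrass_to_jacobiE : weierstrass_to_jacobi c d e =
  (tofrac wj_num1 / tofrac coord2, tofrac wj_num2 / tofrac (coord2 ^+ 2)).
Proof.
rewrite /weierstrass_to_jacobi /wj_num1 /wj_num2.
rewrite !(tofracXn, tofracD, tofracN, tofracM, rmorph_nat).
rewrite -![tofrac _%:MP]/(cst _).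
have n2 := natr_fun_neq0 2 isT; have e0 := cst_neq0 _ e_neq0.
have y0 : tofrac coord2 != 0 by rewrite tofrac_eq0 coord2_neq0.
rewrite (weierstrass_to_jacobi_fst _ _ _ _ _ _ _ n2 e0 y0 cst_a2).
by rewrite (weierstrass_to_jacobi_snd _ _ _ _ _ _ n2 e0 y0).
Qed.

(** Regularity is that of a function of the plane, not of its restriction to the curve, so every
    point with X = 0 is excluded, even one where numerator and denominator both vanish. *)
Lemma jacobi_to_weierstrass_at (K : fieldType) (iota : {rmorphism rat -> K})
  (P Q : K * K) :
  map_at iota (jacobi_to_weierstrass c d e) P Q <->
  [/\ P.1 != 0,
      Q.1 = (2 * iota e * (P.2 + iota e) + iota d * P.1) / P.1 ^+ 2
    & Q.2 = 2 * iota e * (Q.1 + iota a2) / P.1].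
Proof.
have e0 : iota e != 0 by rewrite fmorph_eq0.
have n2 := natr_neq0 K iota 2 isT.
rewrite jacobi_to_weierstrassE /map_at /=.
have [P0|P1] := eqVneq P.1 0.
  (* The line X = 0, which meets [P] at t = [P.2]. The numerator of the first coordinate restricts
     to 2e(t + e), a nonzero polynomial even when t = -e is a root. *)
  pose L (i : 'I_2) : {poly K} := if i == 0 then 0 else 'X.
  split=> [[+ _]|[]//]; case/(fun_at_pole _ _ _ _ _ _ L P.2).
  - by rewrite expf_neq0 ?coord1_neq0.
  - by case=> [[|[|//]] ?]; rewrite /L /= ?P0 ?horner0 ?hornerX.
  - by rewrite rmorphXn /= mmapX mmap1U expr0n.
  - rewrite /jw_num1 !(rmorphD, rmorphM, rmorph_nat) /= !mmapC !mmapX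
      !mmap1U /= mulr0 addr0.
    have -> : 2 * (iota e)%:P * ('X + (iota e)%:P)
      = (2 * iota e) *: 'X + (2 * iota e * iota e)%:P.
      by rewrite -mul_polyC !polyCM -polyC_natr; ring.
    by rewrite linear_poly_neq0 // mulf_neq0.
rewrite !fun_at_quotient ?pevalE ?expf_neq0 //.
split; first by case=> -> ->; split=> //; field; rewrite ?P1 ?n2.
by case=> _ -> ->; split=> //; field; rewrite ?P1 ?n2.
Qed.

Lemma weierstrass_to_jacobi_at (K : fieldType) (iota : {rmorphism rat -> K})
  (P Q : K * K) :
  map_at iota (weierstrass_to_jacobi c d e) P Q <->
  [/\ P.2 != 0,
      Q.1 = 2 * iota e * (P.1 + iota a2) / P.2
    & Q.2 = - iota e + Q.1 * (Q.1 * P.1 - iota d) / (2 * iota e)].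
Proof.
have e0 : iota e != 0 by rewrite fmorph_eq0.
have n2 := natr_neq0 K iota 2 isT.
rewrite weierstrass_to_jacobiE /map_at /=.
have [P0|P2] := eqVneq P.2 0.
  (* The line y = 0, on which the numerator of the first coordinate restricts to 2e(t + a2). *)
  pose L (i : 'I_2) : {poly K} := if i == 0 then 'X else 0.
  split=> [[+ _]|[]//]; case/(fun_at_pole _ _ _ _ _ _ L P.1).
  - exact: coord2_neq0.
  - by case=> [[|[|//]] ?]; rewrite /L /= ?P0 ?horner0 ?hornerX.
  - by rewrite mmapX mmap1U.
  - rewrite /wj_num1 !(rmorphD, rmorphM, rmorph_nat) /= !mmapC !mmapX
      !mmap1U /=.
    have -> : 2 * (iota e)%:P * ('X + (iota a2)%:P)
      = (2 * iota e) *: 'X + (2 * iota e * iota a2)%:P.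
      by rewrite -mul_polyC !polyCM -polyC_natr; ring.
    by rewrite linear_poly_neq0 // mulf_neq0.
rewrite !fun_at_quotient ?pevalE ?expf_neq0 //.
split; first by case=> -> ->; split=> //; field; rewrite ?P2 ?e0 ?n2.
by case=> _ -> ->; split=> //; field; rewrite ?P2 ?e0 ?n2.
Qed.

Lemma jacobi_to_weierstrass_defined (K : fieldType)
  (iota : {rmorphism rat -> K}) (P : K * K) :
  P.1 != 0 -> exists Q, map_at iota (jacobi_to_weierstrass c d e) P Q.
Proof.
move=> P1; eexists (_, _); apply/jacobi_to_weierstrass_at.
by split=> /=; [exact: P1 | reflexivity | reflexivity].
Qed.

Lemma weierstrass_to_jacobi_defined (K : fieldType)
  (iota : {rmorphism rat -> K}) (P : K * K) :
  P.2 != 0 -> exists Q, map_at iota (weierstrass_to_jacobi c d e) P Q.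
Proof.
move=> P2; eexists (_, _); apply/weierstrass_to_jacobi_at.
by split=> /=; [exact: P2 | reflexivity | reflexivity].
Qed.

(** * The two curves, and the maps between them *)

Variable b : rat.

Definition jacobi : plane_poly := jacobi_quartic 1 b c d e.
(** The factors [1] stand for [a], so that the coefficients agree syntactically with those of the
    theorem once [a] is replaced by 1. *)
Definition cubic : plane_poly :=
  weierstrass (d / e) a2 (2 * e * b) (- (4 * e ^+ 2 * 1))
    (1 * (d ^+ 2 - 4 * e ^+ 2 * c)).

Lemma on_jacobi (K : fieldType) (iota : {rmorphism rat -> K}) (P : K * K) :
  on_curve iota jacobi P <->
  P.2 ^+ 2 = P.1 ^+ 4 + iota b * P.1 ^+ 3 + iota c * P.1 ^+ 2 + iota d * P.1
             + iota e ^+ 2.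
Proof.
rewrite /on_curve /jacobi /jacobi_quartic !pevalE rmorph1 mul1r.
by split=> [/eqP|->]; rewrite ?subrr // subr_eq0 => /eqP.
Qed.

Lemma image_a2 (K : fieldType) (iota : {rmorphism rat -> K}) :
  iota a2 = iota c - iota d ^+ 2 / (4 * iota e ^+ 2).
Proof. by rewrite a2_def rmorphB fmorph_div rmorphXn rmorphM rmorphXn rmorph_nat. Qed.

(** The right-hand side factors because a6 = d^2 - 4e^2 c equals -4e^2 a2. *)
Lemma on_cubic (K : fieldType) (iota : {rmorphism rat -> K}) (P : K * K) :
  on_curve iota cubic P <->
  P.2 ^+ 2 + iota d / iota e * P.1 * P.2 + 2 * iota e * iota b * P.2 =
  (P.1 + iota a2) * (P.1 ^+ 2 - 4 * iota e ^+ 2).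
Proof.
have e0 : iota e != 0 by rewrite fmorph_eq0.
have n4 := natr_neq0 K iota 4 isT.
have a2E : iota d ^+ 2 = 4 * iota e ^+ 2 * (iota c - iota a2).
  by rewrite image_a2; field; rewrite ?e0 ?n4.
rewrite /on_curve /cubic /weierstrass !pevalE fmorph_div mulr1 mul1r.
rewrite rmorphN rmorphB !(rmorphXn, rmorphM, rmorph_nat) a2E.
rewrite (_ : _ + - _ = P.2 ^+ 2 + iota d / iota e * P.1 * P.2
  + 2 * iota e * iota b * P.2 - (P.1 + iota a2) * (P.1 ^+ 2 - 4 * iota e ^+ 2));
  last by ring.
by split=> [/eqP|->]; rewrite ?subrr // subr_eq0 => /eqP.
Qed.

Lemma rational_map_jacobi_to_weierstrass :
  rational_map jacobi cubic (jacobi_to_weierstrass c d e).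
Proof.
move=> K iota; have e0 : iota e != 0 by rewrite fmorph_eq0.
have n2 := natr_neq0 K iota 2 isT; split; last first.
  move=> [X Z] [x y] /on_jacobi/= onJ /jacobi_to_weierstrass_at[/= X0 -> ->].
  apply/on_cubic/(jacobi_to_weierstrass_eq _ _ _ _ (iota c)) => //.
  exact: image_a2.
(* At X = 0 the quartic reads Z^2 = e^2, which leaves two points. *)
exists [:: (0, iota e); (0, - iota e)] => -[X Z] /on_jacobi/= onJ.
have [X0|X0] := eqVneq X 0; last first.
  by move=> _; apply: jacobi_to_weierstrass_defined.
move: onJ; rewrite X0 !expr0n /= !mulr0 !add0r => /eqP.
by rewrite eqf_sqr !inE !xpair_eqE eqxx => ->.
Qed.

(** The roots of the factored right-hand side; they bound the set of points at which the map to the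
    quartic has a pole. *)
Lemma cubic_y0 (K : fieldType) (iota : {rmorphism rat -> K}) (x : K) :
  on_curve iota cubic (x, 0) ->
  x \in [:: - iota a2; 2 * iota e; - (2 * iota e)].
Proof.
move/on_cubic => /= /esym/eqP.
rewrite expr0n /= !mulr0 !addr0 mulf_eq0 addr_eq0 subr_eq0.
have -> : 4 * iota e ^+ 2 = (2 * iota e) ^+ 2 by ring.
by rewrite eqf_sqr !inE.
Qed.

Lemma rational_map_weierstrass_to_jacobi :
  rational_map cubic jacobi (weierstrass_to_jacobi c d e).
Proof.
move=> K iota; have e0 : iota e != 0 by rewrite fmorph_eq0.
have n2 := natr_neq0 K iota 2 isT; split; last first.
  move=> [x y] [X Z] /on_cubic/= onW /weierstrass_to_jacobi_at[/= y0 -> ->].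
  apply/on_jacobi/(weierstrass_to_jacobi_eq _ _ _ _ (iota c)) => //.
  exact: image_a2.
exists [seq (x, 0) | x <- [:: - iota a2; 2 * iota e; - (2 * iota e)]].
move=> [x y] onW; have [y0|y0] := eqVneq y 0; last first.
  by move=> _; apply: weierstrass_to_jacobi_defined.
by rewrite y0 in onW *; rewrite (map_f _ (cubic_y0 _ _ _ onW)).
Qed.

(** The substitutions cancel on the whole plane, off the poles, hence the arbitrary [F]. *)
Lemma jacobi_to_weierstrassK (F : plane_poly) :
  Defs.left_inverse F (jacobi_to_weierstrass c d e) (weierstrass_to_jacobi c d e).
Proof.
move=> K iota [X Z] [x y] [X' Z'] _.
have e0 : iota e != 0 by rewrite fmorph_eq0.
have n2 := natr_neq0 K iota 2 isT.
case/jacobi_to_weierstrass_at => /= X0 defx defy.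
case/weierstrass_to_jacobi_at => /= y0 -> ->.
(* The factor to be cancelled in 2e(x + a2)/y = X is nonzero, since it divides y. *)
have xA0 : x + iota a2 != 0.
  by apply: contraNneq y0; rewrite defy => ->; rewrite mulr0 mul0r.
have -> : 2 * iota e * (x + iota a2) / y = X.
  by rewrite defy; field; rewrite ?X0 ?xA0 ?e0 ?n2.
by congr pair; rewrite defx; field; rewrite ?X0 ?e0 ?n2.
Qed.

Lemma weierstrass_to_jacobiK (F : plane_poly) :
  Defs.left_inverse F (weierstrass_to_jacobi c d e) (jacobi_to_weierstrass c d e).
Proof.
move=> K iota [x y] [X Z] [x' y'] _.
have e0 : iota e != 0 by rewrite fmorph_eq0.
have n2 := natr_neq0 K iota 2 isT.
case/weierstrass_to_jacobi_at => /= y0 defX ->.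
case/jacobi_to_weierstrass_at => /= X0 -> ->.
have xA0 : x + iota a2 != 0.
  by apply: contraNneq X0; rewrite defX => ->; rewrite mulr0 mul0r.
rewrite (_ : (_ + iota d * X) / X ^+ 2 = x); last first.
  by field; rewrite ?X0 ?e0 ?n2.
by congr pair; rewrite defX; field; rewrite ?y0 ?xA0 ?e0 ?n2.
Qed.

Lemma composite_dense_cubic :
  composite_dense cubic (weierstrass_to_jacobi c d e)
    (jacobi_to_weierstrass c d e).
Proof.
move=> K iota; have e0 : iota e != 0 by rewrite fmorph_eq0.
have n2 := natr_neq0 K iota 2 isT.
(* The composite also fails where the first map gives X = 0, that is x = -a2. There the cubic
   becomes y(y - a1 a2 + a3) = 0, so the only such point with y nonzero has y = a1 a2 - a3. *)
exists ((- iota a2, iota d / iota e * iota a2 - 2 * iota e * iota b)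
  :: [seq (x, 0) | x <- [:: - iota a2; 2 * iota e; - (2 * iota e)]]).
move=> [x y] onW; rewrite inE negb_or => /andP[notin1 notin2].
have y0 : y != 0.
  by apply: contraNneq notin2 => y0; rewrite y0 in onW *; apply/map_f/cubic_y0.
have xA0 : x + iota a2 != 0.
  apply: contraNneq notin1 => /eqP; rewrite addr_eq0 => /eqP defx.
  move/on_cubic: onW => /=; rewrite defx addNr mul0r => /eqP.
  have -> : y ^+ 2 + iota d / iota e * - iota a2 * y + 2 * iota e * iota b * y
    = y * (y - (iota d / iota e * iota a2 - 2 * iota e * iota b)) by ring.
  by rewrite mulf_eq0 (negPf y0) subr_eq0 => /eqP->.
have [Q gQ] := weierstrass_to_jacobi_defined _ iota (x, y) y0.
have [|R fR] := jacobi_to_weierstrass_defined _ iota Q; last by exists Q, R.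
have [_ -> _] := (weierstrass_to_jacobi_at _ _ _ _).1 gQ.
by rewrite !mulf_neq0 ?invr_eq0.
Qed.

(** * Nonemptiness of the domains, and the theorem *)

(** One rational point witnesses nonemptiness: X nonzero makes the first map regular there, and the
    last hypothesis makes y nonzero at the image, so that the map back is regular too. *)
Lemma isomorphic_jacobi_cubic (P : rat * rat) :
  on_curve idfun jacobi P -> P.1 != 0 ->
  2 * e * (P.2 + e) + d * P.1 + a2 * P.1 ^+ 2 != 0 ->
  isomorphic_via jacobi cubic (jacobi_to_weierstrass c d e)
    (weierstrass_to_jacobi c d e).
Proof.
case: P => X Z onJ /= X0 nz.
split; [exact: rational_map_jacobi_to_weierstrass
  | exact: rational_map_weierstrass_to_jacobi
  | exact: jacobi_to_weierstrassK | exact: weierstrass_to_jacobiK |].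
pose x := (2 * e * (Z + e) + d * X) / X ^+ 2.
pose y := 2 * e * (x + a2) / X.
have fP : map_at idfun (jacobi_to_weierstrass c d e) (X, Z) (x, y).
  exact/jacobi_to_weierstrass_at.
have y0 : y != 0.
  have -> : y = 2 * e * (2 * e * (Z + e) + d * X + a2 * X ^+ 2) / X ^+ 3.
    by rewrite /y /x; field; rewrite X0.
  by rewrite !mulf_neq0 ?invr_eq0 ?expf_neq0.
have [[X' Z'] gQ] : exists R,
    map_at idfun (weierstrass_to_jacobi c d e) (x, y) R.
  exact: weierstrass_to_jacobi_defined.
exists rat, idfun, (X, Z), (x, y); split=> //.
  by case: (rational_map_jacobi_to_weierstrass _ idfun) => _ /(_ _ _ onJ); apply.
(* The value of the map back is the starting point by the left-inverse property. *)
by rewrite -(jacobi_to_weierstrassK _ _ _ _ _ _ onJ fP gQ).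
Qed.

End Maps.

Theorem theorem2p25 (p q : nat) (n a b c d e : rat)
  (p_prime : prime p) (q_prime : prime q) (n_def : n = (p * q)%N%:R)
  (a_def : a = 1) (b_def : b = - (16 * n))
  (c_def : c = 2 * n ^+ 4 + 92 * n ^+ 2 + 2)
  (d_def : d = - (16 * n ^+ 5 + 224 * n ^+ 3 + 16 * n))
  (e_def : e ^+ 2 = n ^+ 8 + 28 * n ^+ 6 + 198 * n ^+ 4 + 28 * n ^+ 2 + 1) :
  let a1 := d / e in
  let a3 := 2 * e * b in
  let a2 := c - d ^+ 2 / (4 * e ^+ 2) in
  let a4 := - (4 * e ^+ 2 * a) in
  let a6 := a * (d ^+ 2 - 4 * e ^+ 2 * c) in
  isomorphic_via (jacobi_quartic a b c d e) (weierstrass a1 a2 a3 a4 a6)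
    (jacobi_to_weierstrass c d e) (weierstrass_to_jacobi c d e) /\
  composite_dense (weierstrass a1 a2 a3 a4 a6)
    (weierstrass_to_jacobi c d e) (jacobi_to_weierstrass c d e).
Proof.
move=> a1 a3 a2 a4 a6; rewrite /a4 /a6 a_def.
have n_gt0 : 0 < n by rewrite n_def Num.Theory.ltr0n muln_gt0 !prime_gt0.
(* The given value of e^2 is the square of m = n^4 + 14n^2 + 1, which is positive; hence e = m or e
   = -m, and e is nonzero. *)
have m_sq : e ^+ 2 = (n ^+ 4 + 14 * n ^+ 2 + 1) ^+ 2 by rewrite e_def; ring.
have m_gt0 : 0 < n ^+ 4 + 14 * n ^+ 2 + 1 by nra.
have e0 : e != 0.
  by rewrite -sqrf_eq0 m_sq expf_neq0 // Num.Theory.lt0r_neq0.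
split; last by apply: composite_dense_cubic.
(* The quartic is Z^2 = (X^2 - 8nX + m)^2, and X = 8n is the nonzero abscissa at which X^2 - 8nX
   vanishes, so Z = e satisfies Z^2 = m^2 there. *)
apply: (@isomorphic_jacobi_cubic c d e a2 e0 erefl b (8 * n, e)).
- by apply/on_jacobi => //=; rewrite b_def c_def d_def; ring.
- by rewrite /= mulf_neq0 // Num.Theory.lt0r_neq0.
have -> : 2 * e * (e + e) + d * (8 * n) + a2 * (8 * n) ^+ 2 = 4 * e ^+ 2.
  (* Since d = -16nm, d^2/(4e^2) = 64n^2 and a2 = c - 64n^2 = 2m. Then 8nd and 64n^2 a2 cancel,
     leaving 4e^2. *)
  have -> : a2 = 2 * (n ^+ 4 + 14 * n ^+ 2 + 1).
    rewrite /a2 m_sq c_def d_def; field.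
    by rewrite Num.Theory.lt0r_neq0.
  have -> : 2 * e * (e + e) = 4 * e ^+ 2 by ring.
  by rewrite m_sq d_def; ring.
by rewrite mulf_neq0 ?expf_neq0.
Qed.
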